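(* Let $(X,s)$ be a minimal dynamical system and let $x\in X$. The system $(X,s)$ has quasi-discrete spectrum if and only if the linear span of $\omega_x\mathcal{C}(X)\cap\mathcal{P}$ is dense in $\omega_x\mathcal{C}(X)$. Therefore, if $(X,s)$ has quasi-discrete spectrum, then $\omega_x\mathcal{C}(X)\subseteq\mathcal{W}$.
   Context: A dynamical system is a pair $(X,s)$ with $X$ a compact Hausdorff space and $s:X\to X$ a homeomorphism; it is minimal if every orbit $\{s^nx:n\in\mathbb{Z}\}$ is dense in $X$. $\mathcal{C}(X)$ is the algebra of continuous complex-valued functions on $X$ with the supremum norm; $\mathbb{T}$ is the unit circle in $\mathbb{C}$; $\mathcal{C}(X,\mathbb{T})$ is the multiplicative group of continuous functions $X\to\mathbb{T}$; $s^*f=f\circ s$. Define $G_0(X,s)$ as the group of constant functions $X\to\mathbb{T}$ and $G_{m+1}(X,s)=\{g\in\mathcal{C}(X,\mathbb{T}): s^*g=fg\text{ for some }f\in G_m(X,s)\}$ for $m\ge0$; $G(X,s)=\bigcup_{m\ge0}G_m(X,s)$ (the quasi-eigenfunctions). $(X,s)$ has (topological) quasi-discrete spectrum if the linear span of $G(X,s)$ is dense in $\mathcal{C}(X)$. For $x\in X$, $\omega_x:\mathcal{C}(X)\to l^\infty(\mathbb{Z})$ is $\omega_x(f)(n)=f(s^nx)$. $\mathcal{P}\subseteq l^\infty(\mathbb{Z})$ is the set of all functions $n\mapsto e^{i2\pi p(n)}$ with $p:\mathbb{Z}\to\mathbb{R}$ a polynomial (real coefficients), and $\mathcal{W}$ is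 the smallest closed linear subspace of $l^\infty(\mathbb{Z})$ containing $\mathcal{P}$. *)

(* Defs.v *)
From HB Require Import structures.
From mathcomp Require Import all_boot all_order all_algebra.
From mathcomp Require Import complex.
From mathcomp Require Import all_classical all_reals all_analysis.

Set Implicit Arguments.
Unset Strict Implicit.
Unset Printing Implicit Defensive.

Import Order.TTheory GRing.Theory Num.Theory.
Import numFieldNormedType.Exports.
Import Normc.

Local Open Scope classical_set_scope.
Local Open Scope ring_scope.
Local Open Scope complex_scope.

HB.instance Definition _ (R : realType) := NormedModule.copy R[i] R[i]^o.

(* [linfty R T] is the space of bounded functions T -> R[i] with the supremum
   norm; [normc z : R] is the modulus, and `|z| = (normc z)%:C in R[i]. *)
Section linfty.
Context {R : realType} {T : Type}.

Definition bounded_pred : {pred T -> R[i]} := [pred f | `[< bounded_fun f >]].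

Lemma bounded_predP (f : T -> R[i]) :
  reflect (exists M : R, forall x, normc (f x) <= M) (f \in bounded_pred).
Proof.
apply: (iffP (asboolP _)) => [fb|[M fM]]; last first.
  exists M%:C; split; first by rewrite complex_real.
  by move=> N MN x _; apply: le_trans (ltW MN); rewrite lecR.
have [[a b] _ fM] := pinfty_ex_gt0 fb.
exists a => x; have : ((normc (f x))%:C <= a +i* b)%R := fM x I.
by rewrite lecE => /andP[].
Qed.

Lemma bounded_pred_submod : submod_closed bounded_pred.
Proof.
split.
  by apply/bounded_predP; exists 0 => x; rewrite normc0.
move=> a f g /bounded_predP[M fM] /bounded_predP[N gN].
apply/bounded_predP; exists (normc a * M + N) => x.
apply: le_trans (le_normcD _ _) _; apply: lerD (gN x).
rewrite normcM ler_wpM2l//.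
by rewrite -lecR; exact: (normr_ge0 (a : R[i])).
Qed.
HB.instance Definition _ :=
  GRing.isSubmodClosed.Build R[i] (T -> R[i]) bounded_pred bounded_pred_submod.

Record linfty :=
  Linfty { linfty_val :> T -> R[i]; linftyP : linfty_val \in bounded_pred }.
HB.instance Definition _ := [isSub for linfty_val].
HB.instance Definition _ := [Choice of linfty by <:].
HB.instance Definition _ := [SubChoice_isSubLmodule of linfty by <:].

Definition supnorm (f : linfty) : R := sup [set normc (f x) | x in [set: T]].

Lemma supnorm_has_ub (f : linfty) :
  has_ubound [set normc (f x) | x in [set: T]].
Proof.
by case: f => f /= /bounded_predP[M fM]; exists M => _ [x _ <-] /=.
Qed.

Lemma normc_le_supnorm (f : linfty) x : normc (f x) <= supnorm f.
Proof. by apply: ub_le_sup; [exact: supnorm_has_ub|exists x]. Qed.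

Lemma supnorm_le (f : linfty) (M : R) :
  0 <= M -> (forall x, normc (f x) <= M) -> supnorm f <= M.
Proof.
move=> M0 fM; rewrite /supnorm; set A := (X in sup X).
have [->|/set0P ne] := eqVneq A set0; first by rewrite sup0.
by apply: ge_sup => // _ [x _ <-] /=.
Qed.

Lemma normc_ge0 (z : R[i]) : 0 <= normc z.
Proof. by rewrite -lecR; exact: (normr_ge0 z). Qed.

Lemma supnorm_ge0 (f : linfty) : 0 <= supnorm f.
Proof.
have := normc_le_supnorm f; rewrite /supnorm; set A := (X in sup X) => fA.
have [->|/set0P[_ [x _ _]]] := eqVneq A set0; first by rewrite sup0.
exact: le_trans (normc_ge0 (f x)) (fA x).
Qed.

Lemma supnormD (f g : linfty) :
  (supnorm (f + g))%:C <= (supnorm f)%:C + (supnorm g)%:C.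
Proof.
rewrite -rmorphD lecR; apply: supnorm_le => [|x].
  by rewrite addr_ge0// supnorm_ge0.
by apply: le_trans (le_normcD _ _) _; apply: lerD; exact: normc_le_supnorm.
Qed.

Lemma supnormZ (a : R[i]) (f : linfty) :
  (supnorm (a *: f))%:C = `|a| * (supnorm f)%:C.
Proof.
rewrite -[`|a|]/((normc a)%:C) -rmorphM; congr _%:C; apply/eqP.
have leZ b (g : linfty) : supnorm (b *: g) <= normc b * supnorm g.
  apply: supnorm_le => [|x]; first by rewrite mulr_ge0 ?normc_ge0 ?supnorm_ge0.
  by rewrite [_ x]/(b * g x) normcM ler_wpM2l ?normc_ge0 ?normc_le_supnorm.
rewrite eq_le leZ /=; have [->|a0] := eqVneq a 0.
  by rewrite normc0 mul0r supnorm_ge0.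
have na : 0 < normc a.
  rewrite lt_neqAle normc_ge0 andbT eq_sym.
  by apply: contra a0 => /eqP/eq0_normc ->.
rewrite mulrC -ler_pdivlMr// mulrC -normcV.
have := leZ a^-1 (a *: f).
by rewrite scalerA mulVf// scale1r.
Qed.

Lemma supnorm0_eq0 (f : linfty) : (supnorm f)%:C = 0 -> f = 0.
Proof.
move=> [f0]; apply/val_inj/funext => x.
apply: eq0_normc; apply/eqP.
by rewrite eq_le normc_ge0 andbT -f0 normc_le_supnorm.
Qed.

HB.instance Definition _ :=
  Lmodule_isNormed.Build R[i] linfty supnormD supnormZ supnorm0_eq0.

Lemma linfty_normE (f : linfty) : `|f| = (supnorm f)%:C.
Proof. by []. Qed.

End linfty.
Arguments linfty R T : clear implicits.

Lemma normc_subr (R : realType) (a b : R[i]) :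
  (normc a : R) - normc b <= normc (a - b).
Proof. by rewrite lerBlDr; apply: le_trans (le_normcD _ _); rewrite subrK. Qed.

Lemma compact_continuous_bounded (R : realType) (X : topologicalType)
    (f : X -> R[i]) :
  compact [set: X] -> continuous f -> f \in bounded_pred.
Proof.
move=> cX cf; apply/bounded_predP.
have cnf : continuous (fun x => normc (f x) : R).
  move=> x; apply/cvgrPdist_lt => e e0.
  have eC : 0 < e%:C by rewrite ltcR.
  have /cvgrPdist_lt/(_ _ eC) := cf x.
  apply: filterS => y /= fxy.
  have {}fxy : normc (f x - f y) < e by rewrite -ltcR.
  apply: le_lt_trans fxy; have tri := normc_subr (f x) (f y).
  have := normc_subr (f y) (f x).
  rewrite -[f y - f x]opprB normcN ler_norml => tri'.
  by rewrite tri andbT lerNl (@opprB R).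
have /compact_bounded : compact ((fun x => normc (f x) : R) @` [set: X]).
  by apply: continuous_compact => //; exact: continuous_subspaceT.
move=> /pinfty_ex_gt0[M _ fM]; exists M => x.
by apply: le_trans (ler_norm _) _; apply: fM; exists x.
Qed.

Section linear.
Context {K : numFieldType} {V : normedModType K}.

Definition linear_span (A : set V) : set V :=
  [set v | exists n (c : 'I_n -> K) (a : 'I_n -> V),
     (forall i, A (a i)) /\ v = \sum_(i < n) c i *: a i].

Definition linear_subspace (A : set V) : Prop :=
  A 0 /\ forall (c : K) (u v : V), A u -> A v -> A (c *: u + v).

Definition dense_in (A B : set V) : Prop := A `<=` B /\ B `<=` closure A.

End linear.

Record homeo (X : topologicalType) := Homeo {
  homeo_fun :> X -> X;
  homeo_inv : X -> X;
  homeoK : cancel homeo_fun homeo_inv;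
  homeo_invK : cancel homeo_inv homeo_fun;
  homeo_continuous : continuous homeo_fun;
  homeo_inv_continuous : continuous homeo_inv }.

Section dynamics.
Context {X : topologicalType} (s : homeo X).

Definition iterz (n : int) (x : X) : X :=
  match n with
  | Posz k => iter k s x
  | Negz k => iter k.+1 (homeo_inv s) x
  end.

Definition minimal : Prop := forall x, dense (range (fun n => iterz n x)).

End dynamics.

Section quasi_discrete_spectrum.
Context (R : realType) {X : topologicalType} (s : homeo X).

(* C(X) as a subset of [linfty R X]; for compact X this misses no continuous
   function, by [compact_continuous_bounded]. *)
Definition CX : set (linfty R X) := [set f | continuous f].

Definition CXT : set (linfty R X) := [set g | CX g /\ forall x, `|g x| = 1].

Fixpoint Gqe (m : nat) : set (linfty R X) :=
  match m with
  | 0 => [set g | CXT g /\ exists c, forall x, g x = c]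
  | m'.+1 => [set g | CXT g /\
                exists2 f, Gqe m' f & forall x, g (s x) = f x * g x]
  end.

Definition quasi_eigenfunctions : set (linfty R X) :=
  \bigcup_(m in [set: nat]) Gqe m.

Definition has_quasi_discrete_spectrum : Prop :=
  dense_in (linear_span quasi_eigenfunctions) CX.

End quasi_discrete_spectrum.
Arguments CX R X : clear implicits.

Section orbit_map.
Context {R : realType} {X : topologicalType} (s : homeo X) (x : X).

Lemma orbit_bounded (f : linfty R X) :
  (fun n : int => f (iterz s n x)) \in bounded_pred.
Proof.
case: f => f /= /bounded_predP[M fM].
by apply/bounded_predP; exists M => n; exact: fM.
Qed.

Definition omega (f : linfty R X) : linfty R int := Linfty (orbit_bounded f).

End orbit_map.

Section polynomial_phases.
Context (R : realType).

Definition expi (t : R) : R[i] := cos t +i* sin t.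

Definition poly_phases : set (linfty R int) :=
  [set u | exists p : {poly R},
     forall n : int, u n = expi (2 * pi * p.[n%:~R])].

Definition Wspace : set (linfty R int) :=
  smallest [set V | closed V /\ linear_subspace V] poly_phases.

End polynomial_phases.
Arguments poly_phases R : clear implicits.
Arguments Wspace R : clear implicits.

(* Main.v *)
(* Since the orbit of x is dense, omega_x is a linear isometry on C(X). It maps
   the quasi-eigenfunctions exactly onto the polynomial phases in its range:
   along the orbit, s^* g = f g says that the phase of f is the forward
   difference of the phase of g, and the forward difference both lowers degrees
   and is surjective on polynomials. Density therefore transfers through
   omega_x. *)
Require Import Defs.
From HB Require Import structures.
From mathcomp Require Import all_boot all_order all_algebra.
From mathcomp Require Import complex zify.
From mathcomp Require Import all_classical all_reals all_analysis.

Set Implicit Arguments.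
Unset Strict Implicit.
Unset Printing Implicit Defensive.

Import Order.TTheory GRing.Theory Num.Theory.
Import numFieldNormedType.Exports.
Import Normc.

Local Open Scope classical_set_scope.
Local Open Scope ring_scope.
Local Open Scope complex_scope.

(** * Linear spans and density in normed spaces *)

Section normed_span.
Context {K : numFieldType}.

Lemma closure_normP (V : normedModType K) (A : set V) (v : V) :
  closure A v <-> forall e : K, 0 < e -> exists2 w, A w & `|v - w| < e.
Proof.
split=> [Av e e0|Av B /nbhs_normP[e /= e0 eB]].
  have /Av[w [Aw vw]] : nbhs v (ball v e) by exact: nbhsx_ballx.
  by exists w => //; move: vw; rewrite -ball_normE.
by have [w Aw vw] := Av _ e0; exists w; split => //; exact: eB.
Qed.

Lemma linear_subspace_span (V : normedModType K) (A C : set V) :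
  linear_subspace C -> A `<=` C -> linear_span A `<=` C.
Proof.
move=> [C0 CD] AC _ [n [c [a [Aa ->]]]].
elim/big_ind: _ => // [u v Cu Cv|i _]; first by rewrite -[u]scale1r; exact: CD.
by rewrite -[_ *: _]addr0; apply: CD => //; apply: AC.
Qed.

Lemma linear_span_image (V W : normedModType K) (f : {linear V -> W})
    (A : set V) : linear_span (f @` A) = f @` linear_span A.
Proof.
apply/seteqP; split=> [_ [n [c [b [fAb ->]]]]|_ [_ [n [c [a [Aa ->]]]] <-]].
  have /choice[a aP] : forall i, exists a, A a /\ f a = b i.
    by move=> i; have [a Aa <-] := fAb i; exists a.
  exists (\sum_(i < n) c i *: a i).
    by exists n, c, a; split=> // i; have [] := aP i.
  rewrite linear_sum; apply: eq_bigr => i _.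
  by rewrite linearZ; congr (_ *: _); have [] := aP i.
exists n, c, (f \o a); split=> [i|]; first by exists (a i).
by rewrite linear_sum; apply: eq_bigr => i _; rewrite linearZ.
Qed.

(** Norm preservation is asked on [C] alone because the orbit map is isometric only on continuous
    functions. As [C] is a subspace, it contains differences of its elements, so [f] preserves
    distances between points of [A] and of [C], and approximations pass both ways. *)
Lemma dense_in_isometry (V W : normedModType K) (f : {linear V -> W})
    (A C : set V) : linear_subspace C -> (forall v, C v -> `|f v| = `|v|) ->
    A `<=` C ->
  dense_in A C <-> dense_in (f @` A) (f @` C).
Proof.
move=> [_ CD] fC AC.
have fB u v : C u -> C v -> `|f u - f v| = `|u - v|.
  by move=> Cu Cv; rewrite -linearB fC// addrC -scaleN1r; exact: CD.
split=> -[_ Cc]; split.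
- exact: image_subset.
- move=> _ [v Cv <-]; apply/closure_normP => e e0.
  have /closure_normP/(_ _ e0)[w Aw vw] := Cc _ Cv.
  by exists (f w); [exists w|rewrite fB//; exact: AC].
- exact: AC.
- move=> v Cv; apply/closure_normP => e e0.
  have /Cc/closure_normP/(_ _ e0)[_ [w Aw <-] vw] : (f @` C) (f v) by exists v.
  by exists w => //; rewrite -fB//; exact: AC.
Qed.

End normed_span.

(** * Forward differences of polynomials *)

Section forward_difference.
Context {R : numFieldType}.
Implicit Types p q : {poly R}.

Definition fdiff p : {poly R} := p \Po ('X + 1) - p.

Lemma horner_fdiff p (x : R) : (fdiff p).[x] = p.[x + 1] - p.[x].
Proof. by rewrite /fdiff !hornerE horner_comp !hornerE. Qed.

Lemma fdiffD p q : fdiff (p + q) = fdiff p + fdiff q.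
Proof. by rewrite /fdiff linearD opprD addrACA. Qed.

Lemma fdiffZ c p : fdiff (c *: p) = c *: fdiff p.
Proof. by rewrite /fdiff linearZ scalerBr. Qed.

(** Binomial expansion of (X + 1)^(n+1): only the leading term of the difference matters later, so
    all lower ones are absorbed into [r]. *)
Lemma fdiffXn n :
  exists2 r : {poly R}, (size r <= n)%N & fdiff 'X^(n.+1) = 'X^n *+ n.+1 + r.
Proof.
exists (\sum_(i < n) 'X^i *+ 'C(n.+1, i)).
  apply: (leq_trans (size_sum _ _ _)); apply/bigmax_leqP => i _.
  rewrite -scaler_nat (leq_trans (size_scale_leq _ _))// size_polyXn.
  exact: ltn_ord.
rewrite /fdiff comp_Xn_poly exprD1n !big_ord_recr/= binn mulr1n.
by rewrite binSn addrK addrC.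
Qed.

Lemma poly_leadE p n : (size p <= n.+1)%N ->
  exists2 p' : {poly R}, (size p' <= n)%N & p = p`_n *: 'X^n + p'.
Proof.
move=> sp; exists (\poly_(i < n) p`_i); first exact: size_poly.
apply/polyP => i; rewrite coefD coefZ coefXn coef_poly.
case: ltngtP => [ni|ni|->]; rewrite ?mulr0 ?mulr1 ?add0r ?addr0//.
by rewrite nth_default// (leq_trans sp).
Qed.

Lemma size_fdiff p n : (size p <= n.+1)%N -> (size (fdiff p) <= n)%N.
Proof.
elim: n p => [|n IH] p sp.
  by rewrite (size1_polyC sp) /fdiff comp_polyC subrr size_poly0.
have [p' sp' ->] := poly_leadE sp; have [r sr dX] := fdiffXn n.
rewrite fdiffD fdiffZ dX (leq_trans (size_polyD _ _))// geq_max.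
rewrite (leq_trans (IH _ sp'))// andbT (leq_trans (size_scale_leq _ _))//.
rewrite (leq_trans (size_polyD _ _))// geq_max (leqW sr) andbT.
by rewrite -scaler_nat (leq_trans (size_scale_leq _ _))// size_polyXn.
Qed.

(** Induction on the size of [p]: in characteristic zero a multiple of X^(n+1) has a difference with
    the leading term of [p]. Constants have difference zero, which leaves the value at 0 free. *)
Lemma fdiff_surj p c : exists2 q, fdiff q = p & q.[0] = c.
Proof.
have [n] := ubnP (size p); elim: n p c => // n IH p c; rewrite ltnS.
case: n IH => [|n] IH sp.
  exists c%:P; last by rewrite hornerC.
  by rewrite /fdiff comp_polyC subrr; apply/esym/eqP; rewrite -size_poly_leq0.
have [p' sp' pE] := poly_leadE sp; have [r sr dX] := fdiffXn n.
have n0 : n.+1%:R != 0 :> R by rewrite pnatr_eq0.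
(* The subtracted multiple of [r] compensates the lower-order terms that the multiple of X^(n+1)
   contributes. *)
have [|q dq q0] := IH (p' - (p`_n / n.+1%:R) *: r) c.
  rewrite ltnS (leq_trans (size_polyD _ _))// geq_max sp' size_polyN.
  exact: leq_trans (size_scale_leq _ _) sr.
exists ((p`_n / n.+1%:R) *: 'X^(n.+1) + q).
  rewrite fdiffD fdiffZ dX dq scalerDr -scalerMnr scalerMnl -mulr_natr divfK//.
  by rewrite -addrA [_ *: r + _]addrC subrK -pE.
by rewrite !hornerE expr0n mulr0 add0r.
Qed.

End forward_difference.

(** * Parametrisation of the unit circle, and auxiliary facts *)

Section expi.
Context {R : realType}.
Implicit Types (a b : R) (z : R[i]).

Lemma expiD a b : expi (a + b) = expi a * expi b.
Proof. by rewrite /expi cosD sinD; simpc; rewrite [_ * _ + _ * _]addrC. Qed.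

Lemma norm_expi a : `|expi a| = 1.
Proof. by rewrite normc_def /= cos2Dsin2 sqrtr1. Qed.

Lemma expi_neq0 a : expi a != 0.
Proof. by rewrite -normr_eq0 norm_expi oner_eq0. Qed.

Lemma expi_surj z : `|z| = 1 -> exists t, z = expi (2 * pi * t).
Proof.
suff H : `|z| = 1 -> exists t, z = expi t.
  move=> /H[t ->]; exists (t / (2 * pi)); congr expi.
  by rewrite mulrC divfK// mulf_neq0 ?gt_eqF ?pi_gt0.
case: z => a b; rewrite normc_def /= => -[] ab.
have {}ab : a ^+ 2 + b ^+ 2 = 1.
  by rewrite -[LHS]sqr_sqrtr ?addr_ge0 ?sqr_ge0// ab expr1n.
have a1 : -1 <= a <= 1.
  rewrite -ler_norml -(@ler_sqr R) ?nnegrE// real_normK ?num_real//.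
  by rewrite expr1n -ab lerDl sqr_ge0.
have sb : sin (acos a) = `|b|.
  by rewrite sin_acos// -ab addrC addKr sqrtr_sqr.
(* The arccosine only reaches the upper half circle; the lower half is obtained by negating the
   angle. *)
have [b0|b0] := leP 0 b.
  by exists (acos a); rewrite /expi acosK// sb ger0_norm.
by exists (- acos a); rewrite /expi cosN sinN acosK// sb ltr0_norm// opprK.
Qed.

End expi.

(** By the reverse triangle inequality, a point outside is at least its radial gap away from the
    annulus. The cases of interest are the unit circle ([a = b = 1]) and a disc ([a = 0]). *)
Lemma closed_annulus (R : realType) (a b : R) :
  closed [set z : R[i] | a <= normc z <= b].
Proof.
move=> z /closure_normP zA /=; apply/andP; split; rewrite leNgt; apply/negP.
  rewrite -subr_gt0 -ltcR => /zA[w /= /andP[aw _]].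
  rewrite ltcR -normcN opprB ltNge => /negP; apply.
  by apply: le_trans (normc_subr _ _); rewrite lerD2r.
rewrite -subr_gt0 -ltcR => /zA[w /= /andP[_ wb]].
rewrite ltcR ltNge => /negP; apply.
by apply: le_trans (normc_subr _ _); rewrite lerD2l lerN2.
Qed.

Lemma int_recurrence (K : idomainType) (a u v : int -> K) :
  (forall n, a n != 0) -> (forall n, u (n + 1) = a n * u n) ->
  (forall n, v (n + 1) = a n * v n) -> u 0 = v 0 -> u =1 v.
Proof.
move=> a0 uS vS uv0; elim/int_ind=> [//|n IH|n IH].
  by rewrite -addn1 PoszD uS vS IH.
(* Stepping backwards: the nonzero factor at -(n+1) is cancelled, which reduces the claim to the one
   at -n. *)
apply: (mulfI (a0 (- n.+1%:Z))); rewrite -uS -vS.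
by rewrite (_ : - n.+1%:Z + 1 = - n%:Z)//; lia.
Qed.

Lemma linear_subspace_CX (R : realType) (X : topologicalType) :
  linear_subspace (CX R X).
Proof.
split=> [|c f g cf cg] y; first exact: cvg_cst.
by apply: cvgD (cg y); apply: cvgMr; exact: cf.
Qed.

(** * The orbit map of a minimal system and its polynomial phases *)

Section orbit.
Context {R : realType} {X : topologicalType} (s : homeo X) (x : X).

Lemma iterzS (n : int) : iterz s (n + 1) x = s (iterz s n x).
Proof.
(* [Negz k] stands for -(k+1), so -1 is a separate case: its successor 0 is a [Posz]. *)
case: n => [n|[|n]]; first by rewrite -PoszD addn1.
- by rewrite /= homeo_invK.
- by rewrite (_ : Negz n.+1 + 1 = Negz n)/= ?homeo_invK// !NegzE; lia.
Qed.

Lemma omega_is_linear : linear (omega s x : linfty R X -> linfty R int).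
Proof. by move=> a f g; exact/val_inj. Qed.

HB.instance Definition _ := GRing.isLinear.Build R[i] (linfty R X)
  (linfty R int) *:%R (omega s x) omega_is_linear.

Hypothesis minimals : minimal s.

(** Otherwise the preimage of the complement of [F] is a nonempty open set, which the dense orbit of
    [x] must meet. *)
Lemma minimal_closed (F : set R[i]) (f : X -> R[i]) :
  continuous f -> closed F -> (forall n, F (f (iterz s n x))) ->
  forall y, F (f y).
Proof.
move=> cf cF fF y; apply: contrapT => nFy.
have ne : (f @^-1` (~` F)) !=set0 by exists y.
have [|z [nFz [n _ nz]]] := minimals x ne.
  by apply: open_comp; [move=> z _; exact: cf|exact: closed_openC].
by apply: nFz; rewrite -nz; exact: fF.
Qed.

Lemma minimal_norm1 (f : X -> R[i]) :
  continuous f -> (forall n, `|f (iterz s n x)| = 1) -> forall y, `|f y| = 1.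
Proof.
move=> cf f1 y; have := minimal_closed cf (@closed_annulus R 1 1) _ y.
rewrite /= -eq_le => nf; congr _%:C; apply/esym/eqP/nf => n.
by have [->] := f1 n; rewrite lexx.
Qed.

Lemma norm_omega (f : linfty R X) : CX R X f -> `|omega s x f| = `|f|.
Proof.
move=> cf; rewrite !linfty_normE; congr _%:C; apply/eqP; rewrite eq_le.
apply/andP; split; apply: supnorm_le; rewrite ?supnorm_ge0//.
  by move=> n; exact: (normc_le_supnorm f).
move=> y.
have cA := @closed_annulus R 0 (supnorm (omega s x f)).
(* The closed disc whose radius is the supremum along the orbit contains all orbit values of [f],
   hence all its values. *)
suff : [set z | 0 <= normc z <= supnorm (omega s x f)] (f y) by case/andP.
apply: (minimal_closed cf cA) => n /=.
by rewrite normc_ge0; exact: (normc_le_supnorm (omega s x f) n).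
Qed.

(** Induction on [m]: if [p] is a phase of the multiplier [f], an antidifference [q] of [p]
    normalised by the phase [t] of [g x] gives a sequence with the same first-order recurrence and
    the same value at 0 as [g] along the orbit. *)
Lemma poly_phases_Gqe m (g : linfty R X) :
  Gqe s m g -> poly_phases R (omega s x g).
Proof.
elim: m g => [g [[_ g1] [c gc]]|m IH g [[_ g1] [f fG gf]]];
    have [t gx] := expi_surj (g1 x).
  by exists t%:P => n; rewrite hornerC -gx [LHS]gc gc.
have [p pE] := IH _ fG; have [q dq q0] := fdiff_surj p t; exists q.
apply: (@int_recurrence _ (fun n => expi (2 * pi * p.[n%:~R]))) => [n|n|n|].
- exact: expi_neq0.
- by rewrite -pE -gf -iterzS.
- by rewrite -expiD -mulrDr -dq horner_fdiff intrD subrK.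
- by rewrite q0 -gx.
Qed.

(** Induction on the degree bound: the quotient of s^*f by [f] is continuous and its phase along the
    orbit is [fdiff p], of smaller degree. Density of the orbit makes [f] unimodular everywhere, so
    the quotient is defined. *)
Lemma Gqe_poly_phase m (p : {poly R}) (f : linfty R X) :
  CX R X f -> (size p <= m.+1)%N ->
  (forall n, omega s x f n = expi (2 * pi * p.[n%:~R])) -> Gqe s m f.
Proof.
elim: m p f => [|m IH] p f cf sp fp; have f1 : CXT f.
1,3: by split=> //; apply: (minimal_norm1 cf) => n;
  rewrite -[f _]/(omega s x f n) fp norm_expi.
- split=> //; exists (expi (2 * pi * p`_0)).
  (* A singleton is closed, and [p] is constant here, so the single value taken on the orbit spreads
     to all of [X]. *)
  apply: (@minimal_closed [set z | z = expi (2 * pi * p`_0)] f) => // [|n].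
    exact/accessible_closed_set1/hausdorff_accessible/norm_hausdorff.
  by rewrite /= -[f _]/(omega s x f n) fp (size1_polyC sp) hornerC coefC.
- split=> //.
  have f0 y : f y != 0 by rewrite -normr_eq0 f1.2 oner_eq0.
  have hb : (fun y => f (s y) / f y) \in bounded_pred.
    apply/bounded_predP; exists 1 => y.
    by rewrite -lecR -[X in X <= _]/(`|f (s y) / f y|) normf_div !f1.2 divr1.
  exists (Linfty hb); last by move=> y /=; rewrite divfK.
  apply: (IH (fdiff p)).
  + move=> y /=; apply: cvgM; last by apply: cvgV => //; exact: cf.
    by apply: continuous_comp; [exact: homeo_continuous|exact: cf].
  + exact: size_fdiff.
  + move=> n /=; apply: (mulIf (expi_neq0 (2 * pi * p.[n%:~R]))).
    rewrite -expiD -mulrDr horner_fdiff subrK -iterzS.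
    have := fp n => /= <-; rewrite divfK//.
    by have := fp (n + 1) => /= ->; rewrite intrD.
Qed.

Lemma omega_quasi_eigenfunctions :
  omega s x @` @quasi_eigenfunctions R X s =
  (omega s x @` CX R X) `&` poly_phases R.
Proof.
apply/seteqP; split=> [_ [g [m _ gG] <-]|_ [[f cf <-] [p fp]]].
  split; last exact: poly_phases_Gqe gG.
  by exists g => //; case: m gG => [|m] [[]].
(* Level [size p] is one more than necessary for nonzero [p], but it also covers the zero
   polynomial. *)
by exists f => //; exists (size p) => //; exact: Gqe_poly_phase fp.
Qed.

End orbit.

(** * Transfer of density through the orbit map *)

Theorem theorem4p5 (R : realType) (X : topologicalType) (s : homeo X) (x : X)
    (compactX : compact [set: X]) (hausdorffX : hausdorff_space X)
    (minimals : minimal s) :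
  (has_quasi_discrete_spectrum R s <->
     dense_in (linear_span ((omega s x @` CX R X) `&` poly_phases R))
              (omega s x @` CX R X))
  /\
  (has_quasi_discrete_spectrum R s -> omega s x @` CX R X `<=` Wspace R).
Proof.
have sub : linear_span (@quasi_eigenfunctions R X s) `<=` CX R X.
  apply: linear_subspace_span; first exact: linear_subspace_CX.
  by move=> g [[|m] _ [[]]].
have spanE : omega s x @` linear_span (@quasi_eigenfunctions R X s) =
    linear_span ((omega s x @` CX R X) `&` poly_phases R).
  by rewrite -omega_quasi_eigenfunctions// linear_span_image.
have denseE : has_quasi_discrete_spectrum R s <->
    dense_in (linear_span ((omega s x @` CX R X) `&` poly_phases R))
             (omega s x @` CX R X).
  rewrite -spanE /has_quasi_discrete_spectrum.
  have iso f : CX R X f -> `|omega s x f| = `|f| by exact: norm_omega.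
  have lin := @linear_subspace_CX R X.
  by have := @dense_in_isometry _ _ _ (omega s x) _ _ lin iso sub.
split=> // /denseE[_ CXc] u /CXc uc V [[Vcl Vlin] PV].
(* Any closed subspace [V] containing the polynomial phases contains the closure of their span,
   where [u] lies by density. *)
apply: Vcl; apply: closure_subset uc; apply: linear_subspace_span => //.
by move=> v [_ /PV].
Qed.
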